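(* There exist transcendental entire functions $f$ and $g$ and a domain in $\mathbb{C}$ which lies in a preperiodic component of $F(f)$ and in a preperiodic component of $F(g)$, and also lies in a preperiodic component of $F(g\circ f)$, but lies in a wandering component of $F(f\circ g)$.
   Context: A domain is a nonempty open connected subset of $\mathbb{C}$. For a transcendental entire function $h$, $h^n$ denotes its $n$-th iterate, and the Fatou set is $F(h)=\{z\in\mathbb{C}: \{h^n\}_{n\in\mathbb{N}} \text{ is normal in some neighborhood of } z\}$. A component of $F(h)$ means a connected component. For a component $U$ of $F(h)$ and $k\ge 0$, let $U_k$ denote the component of $F(h)$ containing $h^k(U)$ (so $U_0=U$). The component $U$ is called wandering if $U_k\cap U_l=\emptyset$ for all $k\neq l$; otherwise it is called preperiodic. A domain lies in a wandering (resp. preperiodic) component of $h$ if it is contained in some wandering (resp. preperiodic) component of $F(h)$. If $f,g$ are transcendental entire, so are $f\circ g$ and $g\circ f$, and these notions apply to them. *)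

(* Defs.v *)
From mathcomp Require Import all_boot all_order all_algebra.
From mathcomp Require Import complex.
From mathcomp Require Import all_classical all_reals all_analysis.

Set Implicit Arguments.
Unset Strict Implicit.
Unset Printing Implicit Defensive.

Import Order.TTheory GRing.Theory Num.Theory.
Import numFieldNormedType.Exports.

Local Open Scope classical_set_scope.
Local Open Scope ring_scope.

(* [R[i]] as a normed module over itself; the [^o] is what gives access to its
   topology and to complex differentiation. *)
Notation CC R := (R[i]^o).

Definition domain (R : realType) (D : set (CC R)) : Prop :=
  [/\ open D, connected D & D !=set0].

(* [derivable] is over the scalar field [R[i]], hence complex differentiability. *)
Definition entire (R : realType) (f : CC R -> CC R) : Prop :=
  forall z : CC R, derivable f z 1.

Definition transcendental_entire (R : realType) (f : CC R -> CC R) : Prop :=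
  entire f /\ ~ exists p : {poly R[i]}, forall z : R[i], f z = p.[z].

Definition locally_uniformly_to (R : realType) (D : set (CC R))
    (u : nat -> CC R -> CC R) (l : CC R -> CC R) : Prop :=
  {family [set K : set (CC R) | compact K /\ K `<=` D], u @ \oo --> l}.

Definition locally_uniformly_to_infinity (R : realType) (D : set (CC R))
    (u : nat -> CC R -> CC R) : Prop :=
  forall K : set (CC R), compact K -> K `<=` D ->
  forall M : R, \forall n \near \oo, forall z, K z -> M%:C%C < `|u n z|.

(* Normality in the sense of maps into the Riemann sphere: on a connected [D],
   the limit of a sequence of holomorphic functions is either finite
   everywhere (and holomorphic) or identically infinite. *)
Definition normal_family (R : realType) (D : set (CC R))
    (F : set (CC R -> CC R)) : Prop :=
  forall u : nat -> CC R -> CC R, (forall n, F (u n)) ->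
  exists2 phi : nat -> nat, {homo phi : m n / (m < n)%N} &
    (exists l : CC R -> CC R, locally_uniformly_to D (u \o phi) l) \/
    locally_uniformly_to_infinity D (u \o phi).

Definition iterates (R : realType) (h : CC R -> CC R) : set (CC R -> CC R) :=
  range (fun n : nat => iter n h).

(* The neighbourhood of [z] is taken connected, as [normal_family] requires. *)
Definition Fatou (R : realType) (h : CC R -> CC R) : set (CC R) :=
  [set z | exists N : set (CC R),
    [/\ domain N, N z & normal_family N (iterates h)]].

Definition component_of (R : realType) (A U : set (CC R)) : Prop :=
  exists2 z, A z & U = connected_component A z.

(* The component [U_k] of the Fatou set containing [h^k(U)]. For [h] entire and
   [U] a component of [Fatou h] it exists and is unique, so the default value
   [set0] is never reached. *)
Definition Fatou_component_iter (R : realType) (h : CC R -> CC R)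
    (U : set (CC R)) (k : nat) : set (CC R) :=
  xget set0 [set V | component_of (Fatou h) V /\ iter k h @` U `<=` V].

Definition wandering (R : realType) (h : CC R -> CC R) (U : set (CC R)) : Prop :=
  forall k l : nat, k <> l ->
  Fatou_component_iter h U k `&` Fatou_component_iter h U l = set0.

Definition preperiodic (R : realType) (h : CC R -> CC R) (U : set (CC R)) : Prop :=
  ~ wandering h U.

Definition lies_in_wandering (R : realType) (h : CC R -> CC R)
    (D : set (CC R)) : Prop :=
  exists U, [/\ component_of (Fatou h) U, wandering h U & D `<=` U].

Definition lies_in_preperiodic (R : realType) (h : CC R -> CC R)
    (D : set (CC R)) : Prop :=
  exists U, [/\ component_of (Fatou h) U, preperiodic h U & D `<=` U].

(* Main.v *)
Require Import Defs.
From mathcomp Require Import all_boot all_order all_algebra.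
From mathcomp Require Import complex.
From mathcomp Require Import all_classical all_reals all_analysis.
From mathcomp Require Import ring lra.

Set Implicit Arguments.
Unset Strict Implicit.
Unset Printing Implicit Defensive.
Import Order.TTheory GRing.Theory Num.Theory.
Import numFieldNormedType.Exports.
Import Normc.
Local Open Scope classical_set_scope.
Local Open Scope ring_scope.

(** Both functions are explicit.  With [u = sin (pi z)] and [v = cos (pi z)] put
<<
  M_s z = u (u + s) / 2 * (z + 1 + u v / pi) * exp (- 100 v^2 (z^2 + v^2)),
  f = M_(-1),  g = M_1.
>>
At the half-odd integer [n + 1/2] the exponential is [1], the middle factor is
[n + 3/2], and the first factor is [1] or [0] according to whether
[s = (-1)^n] or [s = - (-1)^n].  So [g] moves [n + 1/2] to [n + 3/2] for even
[n] and to [0] for odd [n], while [f] does the opposite; both fix [0]. Hence,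
for [x = 1/2],
<<
  f : x -> 0,   g : x -> 3/2 -> 0,   g o f : x -> 0,
  f o g : x -> 5/2 -> 9/2 -> ...
>>
The points [n + 1/2] are critical in all three factors, so these orbits attract
small discs: radii decreasing like [1 / n^3] give a disc [D] around [x] whose
orbit under [f o g] stays in discs around [2 n + 1/2] and tends to infinity
([model_chain]), and which the other three maps send into the disc [B] of radius
[1/128] around the attracting fixed point [0] ([model_fall],
[contracts_model]).

It remains to control whole Fatou components.  For a map [h] that contracts [B]
into itself, let [W] be the set of points whose orbit enters [B].  If [z] is a
Fatou point in the closure of [W] but not in [W], then its orbit keeps a
distance [1/128] from [0]; but a limit of iterates on a neighbourhood of [z] is
[0] at the points of [W], which come arbitrarily close to [z], and locally
uniform convergence makes this absurd.  So every connected subset of the Fatou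
set that meets [W] lies in [W] ([connected_Fatou_basin]).  This shows
that the component of [D] is preperiodic as soon as [D] meets [W], since its
images end in the component of [0] ([lies_in_preperiodic_basin]).  It also gives
the wandering: on the vertical lines [Re z = n] the exponential is so small that
[M_s] maps them into [B] ([model_line]).  Each such line lies in [W], it
separates the points [2 k + 1/2], and these escape, hence are not in [W]
([lies_in_wandering_separated]). *)

(** * The modulus as a real number *)

Section ComplexPlane.
Variable R : realType.
Implicit Types (z w : CC R) (h : CC R -> CC R) (N V : set (CC R)).

(** The norm of [CC R] takes its values in [R[i]]; this is the same number in [R],
where the order is total. *)
Definition cabs (z : CC R) : R := normc (z : R[i]).

Lemma cabsE z : `|z| = (cabs z)%:C%C. Proof. by []. Qed.
Lemma cabs_ge0 z : 0 <= cabs z.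
Proof. by case: z => a b; rewrite /cabs /= sqrtr_ge0. Qed.
Lemma cabs0 : cabs 0 = 0. Proof. exact: normc0. Qed.
Lemma cabs1 : cabs 1 = 1. Proof. exact: normc1. Qed.
Lemma cabsM z w : cabs (z * w) = cabs z * cabs w. Proof. exact: normcM. Qed.
Lemma cabsN z : cabs (- z) = cabs z. Proof. exact: normcN. Qed.
Lemma cabsV z : cabs (z^-1) = (cabs z)^-1. Proof. exact: normcV. Qed.
Lemma cabsD z w : cabs (z + w) <= cabs z + cabs w. Proof. exact: le_normcD. Qed.
Lemma cabsB z w : cabs (z - w) <= cabs z + cabs w.
Proof. by rewrite -(cabsN w) cabsD. Qed.
Lemma cabsX z n : cabs (z ^+ n) = cabs z ^+ n.
Proof. by elim: n => [|n IH]; rewrite ?cabs1 // !exprS cabsM IH. Qed.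
Lemma cabs_real (a : R) : cabs (a%:C%C) = `|a|.
Proof. by rewrite /cabs /= expr0n /= addr0 sqrtr_sqr. Qed.
Lemma cabs_eq0 z : cabs z = 0 -> z = 0. Proof. exact: eq0_normc. Qed.
Lemma Re_le_cabs z : `|complex.Re z| <= cabs z.
Proof. by rewrite -lecR -cabsE; exact: normc_ge_Re. Qed.
Lemma cabs_le_ReIm z : cabs z <= `|complex.Re z| + `|complex.Im z|.
Proof.
rewrite {1}[z]complexE; apply: (le_trans (cabsD _ _)).
rewrite cabsM !cabs_real /cabs /= expr0n expr1n /= add0r sqrtr1 mul1r.
exact: lexx.
Qed.
Lemma Im_le_cabs z : `|complex.Im z| <= cabs z.
Proof.
have := Re_le_cabs (z * 'i%C); rewrite ReiNIm normrN cabsM.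
by rewrite {2}/cabs /= expr0n expr1n /= add0r sqrtr1 mulr1.
Qed.

Lemma nbhs_cabsP z (A : set (CC R)) :
  nbhs z A <-> exists2 e : R, 0 < e & forall w, cabs (w - z) < e -> A w.
Proof.
split.
  move=> /nbhs_ballP[e e0 sub].
  have /complex_realP[r er] : e \is Num.real by apply: gtr0_real.
  subst e; exists r; first by rewrite -ltcR.
  move=> w wz; apply: sub; rewrite -ball_normE /= distrC cabsE ltcR.
  exact: wz.
move=> [e e0 sub]; apply/nbhs_ballP; exists (e%:C)%C; first by rewrite /= ltcR.
move=> w; rewrite -ball_normE /= distrC cabsE ltcR; exact: sub.
Qed.

Lemma continuous_cabsP h z : {for z, continuous h} <->
  forall e : R, 0 < e -> exists2 d : R, 0 < d &
    forall w, cabs (w - z) < d -> cabs (h w - h z) < e.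
Proof.
split.
  move=> hz e e0.
  have /hz/nbhs_cabsP : nbhs (h z) [set w | cabs (w - h z) < e].
    by apply/nbhs_cabsP; exists e.
  by [].
move=> H A /nbhs_cabsP[e e0 sub].
have [d d0 Hd] := H e e0; apply/nbhs_cabsP; exists d => // w wz.
by apply: sub; apply: Hd.
Qed.

Lemma open_cabsP (A : set (CC R)) : open A <->
  forall z, A z -> exists2 e : R, 0 < e & forall w, cabs (w - z) < e -> A w.
Proof.
rewrite openE; split => H z Az; first by apply/nbhs_cabsP; exact: H.
by apply/nbhs_cabsP; exact: H.
Qed.

Lemma real_complex_continuous : continuous (fun t : R => (t%:C)%C : CC R).
Proof.
move=> t A /nbhs_cabsP[e e0 sub]; apply/nbhs_ballP; exists e => //= s ts.
apply: sub; rewrite -rmorphB cabs_real.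
by move: ts; rewrite -ball_normE /= distrC.
Qed.

Lemma Re_continuous : continuous (fun z : CC R => complex.Re z).
Proof.
move=> z A /nbhs_ballP[e e0 sub]; apply/nbhs_cabsP; exists e => // w wz.
apply: sub; rewrite -ball_normE /= distrC.
by apply: le_lt_trans wz; apply: (le_trans _ (Re_le_cabs _)); rewrite raddfB.
Qed.

End ComplexPlane.

(** * Locally uniform convergence *)

Section Convergence.
Variable R : realType.
Implicit Types (z w : CC R) (h l : CC R -> CC R) (N V K : set (CC R)).

Lemma locally_uniformly_toP N (u : nat -> CC R -> CC R) l :
  locally_uniformly_to N u l <->
  forall K, compact K -> K `<=` N -> forall e : R, 0 < e ->
    exists n0, forall n, (n0 <= n)%N -> forall z, K z -> cabs (u n z - l z) < e.
Proof.
rewrite /locally_uniformly_to fam_cvgP; split.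
  move=> H K cK KN e e0.
  have : nbhs (l : {uniform` K -> CC R})
      [set g : CC R -> CC R | forall y, K y -> cabs (g y - l y) < e].
    apply/uniform_nbhs; exists [set xy | ball xy.1 (e%:C)%C xy.2]; split.
      by rewrite -entourage_ballE; exists (e%:C)%C => //=; rewrite ltcR.
    move=> g /= gl y Ky; have := gl y Ky.
    by rewrite -ball_normE /= distrC cabsE ltcR.
  move=> nl; have [n0 _ sub] := H K (conj cK KN) _ nl; exists n0 => n nn0 z Kz.
  exact: (sub n nn0).
move=> H K [cK KN] A /uniform_nbhs[E [entE sub]].
move: entE; rewrite -entourage_ballE => -[e e0 subE].
have /complex_realP[r er] : e \is Num.real by apply: gtr0_real.
subst e.
have r0 : 0 < r by rewrite -ltcR.
have [n0 Hn] := H K cK KN r r0.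
exists n0 => // n /= nn0; apply: sub => y Ky; apply: subE => /=.
by rewrite -ball_normE /= distrC cabsE ltcR; exact: Hn.
Qed.
End Convergence.

(** * Discs and squares *)

Section Discs.
Variable R : realType.
Implicit Types (z w c : CC R) (r : R).

Definition disc (c : CC R) (r : R) : set (CC R) := [set z | cabs (z - c) < r].

Lemma disc_center c r : 0 < r -> disc c r c.
Proof. by move=> r0; rewrite /disc /= subrr cabs0. Qed.

Lemma open_disc c r : open (disc c r).
Proof.
apply/open_cabsP => z zc; exists (r - cabs (z - c)); first by rewrite subr_gt0.
move=> w wz; rewrite /disc /= -[w](subrK z) -addrA.
by apply: (le_lt_trans (cabsD _ _)); rewrite -ltrBrDr.
Qed.

(** A disc is the union of the segments issued from its centre. *)
Lemma connected_disc c r : connected (disc c r).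
Proof.
have [r0|r0] := ltP 0 r; last first.
  suff -> : disc c r = set0 by exact: connected0.
  apply/seteqP; split => // z /= /lt_le_trans/(_ r0).
  by rewrite ltNge cabs_ge0.
pose seg (w : CC R) := [set c + (t%:C)%C * (w - c) | t in `[0%R, 1%R]%classic].
have -> : disc c r = \bigcup_(w in disc c r) seg w.
  apply/seteqP; split => [w wD|w [v vD [t]]].
    by exists w => //; exists 1; rewrite /= ?in_itv /= ?lexx ?ler01 // mul1r addrC subrK.
  rewrite /= in_itv /= => /andP[t0 t1] <-.
  rewrite /disc /= addrC addKr cabsM cabs_real ger0_norm //.
  by apply: le_lt_trans vD; rewrite ler_piMl // cabs_ge0.
apply: bigcup_connected.
  exists c => w wD; exists 0; last by rewrite mul0r addr0.
  by rewrite /= in_itv /= lexx ler01.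
move=> w wD; apply: connected_continuous_connected; first exact: segment_connected.
apply: continuous_subspaceT => t.
apply: cvgD; first exact: cvg_cst.
apply: cvgM; last exact: cvg_cst.
exact: real_complex_continuous.
Qed.

Lemma domain_disc c r : 0 < r -> domain (disc c r).
Proof.
move=> r0; split; [exact: open_disc|exact: connected_disc|].
by exists c; exact: disc_center.
Qed.

(** Squares are convenient compact neighbourhoods, being images of products of
segments. *)
Definition square (c : CC R) (r : R) : set (CC R) :=
  [set z | `|complex.Re (z - c)| <= r /\ `|complex.Im (z - c)| <= r].

Lemma compact_square c r : compact (square c r).
Proof.
pose F (p : R * R) : CC R := c + (p.1%:C)%C + 'i%C * (p.2%:C)%C.
have -> : square c r = F @` (`[- r, r] `*` `[- r, r]).
  apply/seteqP; split => [z [h1 h2]|z [[a b] /= []]].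
    exists (complex.Re (z - c), complex.Im (z - c)).
      by split; rewrite /= in_itv /= -ler_norml.
    by rewrite /F /= -addrA -complexE addrC subrK.
  rewrite !in_itv /= -!ler_norml => ha hb <-.
  have -> : F (a, b) = c + Complex a b.
    by rewrite /F /= -addrA [Complex a b]complexE.
  by split; rewrite addrC addKr.
apply: continuous_compact; last first.
  by apply: compact_setX; exact: segment_compact.
apply: continuous_subspaceT => p.
apply: cvgD; last first.
  apply: cvgM; first exact: cvg_cst.
  apply: (@continuous_comp _ _ _ snd (fun t : R => (t%:C)%C : CC R)).
    exact: cvg_snd.
  exact: real_complex_continuous.
apply: cvgD; first exact: cvg_cst.
apply: (@continuous_comp _ _ _ fst (fun t : R => (t%:C)%C : CC R)).
  exact: cvg_fst.
exact: real_complex_continuous.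
Qed.
End Discs.

(** * Normality of iterates *)

Section Normality.
Variable R : realType.
Implicit Types (z w : CC R) (h l : CC R -> CC R) (N V K : set (CC R)).

Lemma strict_subsequence (P : nat -> nat -> Prop) :
  (forall k n0, exists2 n, (n0 <= n)%N & P k n) ->
  exists2 phi : nat -> nat, {homo phi : m n / (m < n)%N} & forall k, P k (phi k).
Proof.
move=> H.
have [nxt Hn] : exists nxt : nat -> nat -> nat,
    forall k n0, (n0 <= nxt k n0)%N /\ P k (nxt k n0).
  exists (fun k n0 => sval (cid2 (H k n0))) => k n0.
  by case: (cid2 _).
pose phi := fix phi k := if k is k'.+1 then nxt k (phi k').+1 else nxt 0%N 0%N.
exists phi; last by case=> [|k] /=; apply: (Hn _ _).2.
apply: homo_ltn; first exact: ltn_trans.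
by move=> k /=; exact: (Hn _ _).1.
Qed.

(** A sequence of exponents takes some value infinitely often or has a subsequence
tending to infinity.  In the first case the iterates are constant along a
subsequence, so that normality only depends on the second case. *)
Lemma iterates_subsequence (m : nat -> nat) :
  (exists j, exists2 phi : nat -> nat,
     {homo phi : m n / (m < n)%N} & forall k, m (phi k) = j) \/
  (exists2 phi : nat -> nat,
     {homo phi : m n / (m < n)%N} & forall k, (k <= m (phi k))%N).
Proof.
have [H|/existsNP[M]] := pselect (forall M n0, exists2 n, (n0 <= n)%N & (M <= m n)%N).
  by right; exact: (strict_subsequence H).
move=> /existsNP[n0 H]; left.
have {}H : forall n, (n0 <= n)%N -> (m n < M)%N.
  by move=> n nn; rewrite ltnNge; apply/negP => Mm; apply: H; exists n.
suff [j Hj] : exists j, forall n1, exists2 n, (n1 <= n)%N & m n = j.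
  by exists j; apply: (@strict_subsequence (fun=> fun n => m n = j)) => _.
elim: M n0 H => [|M IH] n0 H; first by have := H n0 (leqnn _).
have [HM|/existsNP[n1 HM]] := pselect (forall n1, exists2 n, (n1 <= n)%N & m n = M).
  by exists M.
apply: (IH (maxn n0 n1)) => n; rewrite geq_max => /andP[h0 h1].
have := H _ h0; rewrite ltnS leq_eqVlt => /orP[/eqP e|//].
by exfalso; apply: HM; exists n.
Qed.

Lemma normal_iterates_of_tails N h :
  (forall phi : nat -> nat, (forall k, (k <= phi k)%N) ->
     (exists l, locally_uniformly_to N (fun k => iter (phi k) h) l) \/
     locally_uniformly_to_infinity N (fun k => iter (phi k) h)) ->
  normal_family N (iterates h).
Proof.
move=> H u uF.
have [m Hm] : exists m : nat -> nat, forall n, u n = iter (m n) h.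
  exists (fun n => sval (cid2 (uF n))) => n.
  by case: (cid2 _).
have [[j [phi phiH phij]]|[phi phiH phik]] := iterates_subsequence m.
  exists phi => //; left; exists (iter j h).
  apply/locally_uniformly_toP => K cK KN e e0; exists 0%N => n _ z Kz.
  by rewrite /= Hm phij subrr cabs0.
exists phi => //.
have -> : u \o phi = (fun k => iter (m (phi k)) h).
  by apply/funext => k; rewrite /= Hm.
exact: (H (m \o phi)).
Qed.

Lemma normal_iterates_cst N h (a : CC R) :
  (forall e : R, 0 < e -> exists n0, forall n, (n0 <= n)%N ->
     forall z, N z -> cabs (iter n h z - a) < e) ->
  normal_family N (iterates h).
Proof.
move=> H; apply: normal_iterates_of_tails => phi phik; left; exists (fun=> a).
apply/locally_uniformly_toP => K cK KN e /H[n0 Hn]; exists n0 => n nn0 z Kz.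
apply: Hn; last exact: KN.
exact: (leq_trans nn0).
Qed.

Lemma normal_iterates_infinity N h :
  (forall M : R, exists n0, forall n, (n0 <= n)%N ->
     forall z, N z -> M < cabs (iter n h z)) ->
  normal_family N (iterates h).
Proof.
move=> H; apply: normal_iterates_of_tails => phi phik; right.
move=> K cK KN M; have [n0 Hn] := H M; exists n0 => // n /= nn0 z Kz.
rewrite cabsE ltcR; apply: Hn; last exact: KN.
exact: (leq_trans nn0).
Qed.

End Normality.

(** * Basins of attraction and Fatou components *)

Section Dynamics.
Variable R : realType.
Implicit Types (z w c : CC R) (N V U D : set (CC R)).

(** An attracting fixed point at the origin, described without derivatives. *)
Definition contracts (h : CC R -> CC R) (rho : R) : Prop :=
  [/\ continuous h, 0 < rho &
      forall z, disc 0 rho z -> cabs (h z) <= cabs z / 2].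

Definition basin (h : CC R -> CC R) (rho : R) : set (CC R) :=
  [set z | exists n, disc 0 rho (iter n h z)].

Section Contraction.
Variables (h : CC R -> CC R) (rho : R).
Hypothesis hc : contracts h rho.

Lemma iter_continuous n : continuous (iter n h).
Proof.
have [hcont _ _] := hc.
elim: n => [|n IH] z; first exact: cvg_id.
exact: (continuous_comp (IH z) (hcont _)).
Qed.

Lemma iter_contracts n z : disc 0 rho z -> cabs (iter n h z) <= cabs z / 2 ^+ n.
Proof.
have [_ _ half] := hc => zB.
elim: n => [|n IH]; first by rewrite /= expr0 divr1.
have nB : disc 0 rho (iter n h z).
  rewrite /disc /= subr0; move: zB; rewrite /disc /= subr0; apply: le_lt_trans.
  apply: (le_trans IH); rewrite ler_pdivrMr ?exprn_gt0 //.
  by rewrite ler_peMr ?cabs_ge0 // exprn_ege1 // ler1n.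
apply: (le_trans (half _ nB)).
by rewrite exprS invfM mulrA mulrAC ler_wpM2r // invr_ge0.
Qed.

Lemma iter_disc n z : disc 0 rho z -> disc 0 rho (iter n h z).
Proof.
move=> zB; have := iter_contracts n zB; move: zB; rewrite /disc /= !subr0 => zB H.
apply: le_lt_trans zB; apply: (le_trans H); rewrite ler_pdivrMr ?exprn_gt0 //.
by rewrite ler_peMr ?cabs_ge0 // exprn_ege1 // ler1n.
Qed.

Lemma iter_basin_cvg0 N n : (forall z, N z -> disc 0 rho (iter n h z)) ->
  forall e : R, 0 < e -> exists n0, forall m, (n0 <= m)%N ->
     forall z, N z -> cabs (iter m h z - 0) < e.
Proof.
have [_ rho0 _] := hc => HN e e0.
have [k Hk] : exists k : nat, rho / 2 ^+ k < e.
  have [k hk] : exists k : nat, rho / e < k%:R.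
    by exists (Num.bound (rho / e)); apply: archi_boundP; rewrite ltW // divr_gt0.
  exists k; rewrite ltr_pdivrMr ?exprn_gt0 // mulrC -ltr_pdivrMr //.
  by apply: (lt_le_trans hk); rewrite -natrX ler_nat ltnW // ltn_expl.
exists (k + n)%N => m km z Nz; rewrite subr0.
have -> : m = ((m - n) + n)%N by rewrite subnK // (leq_trans _ km) // leq_addl.
rewrite iterD; apply: (le_lt_trans (iter_contracts _ (HN z Nz))).
have := HN z Nz; rewrite /disc /= subr0 => zr.
apply: le_lt_trans Hk; apply: ler_pM.
- exact: cabs_ge0.
- by rewrite invr_ge0 exprn_ge0.
- exact: ltW.
- rewrite lef_pV2 ?posrE ?exprn_gt0 // ler_weXn2l ?ler1n //.
  by rewrite leq_subRL ?(leq_trans _ km) ?leq_addl // addnC.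
Qed.

Lemma open_basin : open (basin h rho).
Proof.
have -> : basin h rho = \bigcup_n (iter n h @^-1` disc 0 rho).
  by apply/seteqP; split => [z [n hn]|z [n _ hn]]; exists n.
apply: bigcup_open => n _; apply: open_comp; last exact: open_disc.
by move=> z _; exact: iter_continuous.
Qed.

Lemma basin_subset_Fatou : basin h rho `<=` Fatou h.
Proof.
move=> z [n zn].
have /open_cabsP/(_ z zn)[e e0 He] : open (iter n h @^-1` disc 0 rho).
  by apply: open_comp; [move=> ? _; exact: iter_continuous|exact: open_disc].
exists (disc z e); split; first exact: domain_disc.
  exact: disc_center.
apply: (@normal_iterates_cst _ _ _ 0); apply: (@iter_basin_cvg0 _ n) => w.
exact: He.
Qed.

Lemma basin_iter n z : basin h rho (iter n h z) <-> basin h rho z.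
Proof.
split=> -[m]; first by rewrite -iterD => hm; exists (m + n)%N.
by move=> hm; exists m; rewrite -iterD addnC iterD; exact: iter_disc.
Qed.

(** Take a compact neighbourhood [K] of [z] on which a subsequence of the iterates
converges, and suppose that the orbit of [z] never enters the disc.  A finite
limit vanishes at the points of [K] in the basin; one far iterate is uniformly
close to the limit on [K] and continuous at [z], so it is small at [z] too.  The
limit cannot be infinite either, because [K] contains points of the basin. *)
Lemma Fatou_closure_basin z : Fatou h z -> closure (basin h rho) z ->
  basin h rho z.
Proof.
have [_ rho0 _] := hc.
move=> [N [[oN _ _] Nz nN]] clz; apply: contrapT => nbz.
have far n : rho <= cabs (iter n h z).
  by rewrite leNgt; apply/negP => H; apply: nbz; exists n; rewrite /disc /= subr0.
have /open_cabsP/(_ z Nz)[e e0 He] := oN.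
set K := square z (e / 3).
have cK : compact K by exact: compact_square.
have Kz : K z by rewrite /K /square /= subrr /= normr0 divr_ge0 // ltW.
have Kd w : disc z (e / 3) w -> K w.
  rewrite /disc /= => zw; split; apply/ltW/(le_lt_trans _ zw).
    exact: Re_le_cabs.
  exact: Im_le_cabs.
have KN : K `<=` N.
  move=> w [h1 h2]; apply: He; apply: (le_lt_trans (cabs_le_ReIm _)).
  by apply: (le_lt_trans (lerD h1 h2)); lra.
(* Basin points of K that the n-th iterate cannot tell apart from z. *)
have near n (d : R) : 0 < d ->
    exists w, [/\ basin h rho w, K w & cabs (iter n h w - iter n h z) < d].
  move=> d0; have /continuous_cabsP/(_ d d0)[d' d'0 Hd] := @iter_continuous n z.
  have /clz[w [bw [zw1 zw2]]] : nbhs z (disc z (e / 3) `&` disc z d').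
    by apply: filterI; apply/nbhs_cabsP; [exists (e / 3) => //; lra|exists d'].
  by exists w; split => //; [exact: Kd|exact: Hd].
have small w (d : R) : basin h rho w -> 0 < d ->
    exists n0, forall m, (n0 <= m)%N -> cabs (iter m h w) < d.
  move=> [n hn] d0; have [|n0 Hn0] := @iter_basin_cvg0 [set w] n _ d d0.
    by move=> _ ->.
  by exists n0 => m hm; rewrite -[X in cabs X]subr0; exact: Hn0.
have [phi phiH lim] := nN (fun n => iter n h) (fun n => ex_intro2 _ _ n I erefl).
have phik k : (k <= phi k)%N.
  by elim: k => // k IH; apply: (leq_ltn_trans IH); exact: phiH.
case: lim => [[l /locally_uniformly_toP/(_ K cK KN)]|inf].
  have r8 : 0 < rho / 8 by lra.
  move=> /(_ _ r8)[n0 Hn0].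
  have [w [bw Kw wz]] := near (phi n0) _ r8.
  have [n1 Hn1] := small w _ bw r8.
  have h1 := Hn0 n0 (leqnn _) w Kw.
  have h2 := Hn0 (maxn n0 n1) (leq_maxl _ _) w Kw.
  have h3 := Hn1 (phi (maxn n0 n1)) (leq_trans (leq_maxr _ _) (phik _)).
  have := far (phi n0); apply/negP; rewrite -ltNge.
  rewrite /= in h1 h2.
  set a := iter (phi n0) h z; set b := iter (phi n0) h w in h1 wz *.
  set c := iter (phi (maxn n0 n1)) h w in h2 h3.
  (* The subsequence at z is compared with the limit at w through its own term
     at w, and the limit at w with a later term, which is already small. *)
  have -> : a = - (b - a) + ((b - l w) + (- (c - l w) + c)) by ring.
  apply: (le_lt_trans (cabsD _ _)); rewrite cabsN.
  have := cabsD (b - l w) (- (c - l w) + c).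
  have := cabsD (- (c - l w)) c; rewrite cabsN.
  rewrite -/a -/b in wz; lra.
have [w [bw Kw _]] := near 0%N _ rho0.
have [n0 _ Hn0] := inf K cK KN rho.
have [n1 Hn1] := small w _ bw rho0.
have := Hn0 (maxn n0 n1) (leq_maxl _ _) w Kw.
rewrite /= cabsE ltcR ltNge => /negP; apply; apply/ltW/Hn1.
exact: (leq_trans (leq_maxr _ _) (phik _)).
Qed.

(** The basin is open, and relatively closed in the Fatou set by
[Fatou_closure_basin]. *)
Lemma connected_Fatou_basin V : connected V -> V `<=` Fatou h ->
  V `&` basin h rho !=set0 -> V `<=` basin h rho.
Proof.
move=> cV VF V0.
suff <- : V `&` basin h rho = V by exact: subIsetr.
apply: cV => //.
  by exists (basin h rho) => //; exact: open_basin.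
exists (closure (basin h rho)); first exact: closed_closure.
apply/seteqP; split => z [Vz bz]; split => //.
  exact: subset_closure.
by apply: Fatou_closure_basin => //; exact: VF.
Qed.

Lemma component_contains U D : component_of (Fatou h) U ->
  connected D -> D `<=` Fatou h -> U `&` D !=set0 -> D `<=` U.
Proof.
move=> [z _ ->] cD DF [w [Uw Dw]].
rewrite (same_connected_component Uw).
exact: connected_component_max.
Qed.

(** The whole component of [D] lies in the basin, which is mapped into the Fatou
set.  All its images from some time on therefore meet the disc around [0], and
the components containing them contain [0]. *)
Lemma lies_in_preperiodic_basin D : domain D -> D `<=` basin h rho ->
  lies_in_preperiodic h D.
Proof.
have [_ rho0 _] := hc.
move=> [oD cD [x Dx]] Db.
have DF : D `<=` Fatou h by move=> z /Db; exact: basin_subset_Fatou.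
pose U := connected_component (Fatou h) x.
have FU : component_of (Fatou h) U by exists x => //; exact: DF.
have DU : D `<=` U by exact: connected_component_max.
exists U; split => // wand.
have Ub : U `<=` basin h rho.
  apply: connected_Fatou_basin; first exact: component_connected.
    exact: connected_component_sub.
  by exists x; split; [exact: DU|exact: Db].
have [n xn] := Db _ Dx.
have key m : (n <= m)%N -> Fatou_component_iter h U m 0.
  move=> nm; have xm : disc 0 rho (iter m h x).
    by rewrite -(subnK nm) iterD; exact: iter_disc.
  have hUF : iter m h @` U `<=` Fatou h.
    move=> _ [w Uw <-]; apply: basin_subset_Fatou.
    by apply/basin_iter; exact: Ub.
  have hUx : (iter m h @` U) (iter m h x) by exists x => //; exact: DU.
  rewrite /Fatou_component_iter; case: xgetP => [V _ [FV UV]|].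
    apply: (component_contains FV (@connected_disc _ 0 rho)).
    - by move=> z Bz; apply: basin_subset_Fatou; exists 0%N.
    - by exists (iter m h x); split => //; exact: UV.
    - exact: disc_center.
  move=> /(_ (connected_component (Fatou h) (iter m h x))); case; split.
    by exists (iter m h x) => //; exact: hUF.
  apply: connected_component_max => //.
  apply: connected_continuous_connected; first exact: component_connected.
  by apply: continuous_subspaceT => z; exact: iter_continuous.
have := wand n n.+1 (n_Sn n); apply/eqP/set0P.
by exists 0; split; apply: key.
Qed.

(** If two images of the component of [x] were in the same component, this
component would contain two points of the orbit of [x], hence meet one of the
lines between them.  It would be contained in the basin, and so would [x]. *)
Lemma lies_in_wandering_separated D x (a : nat -> R) :
  domain D -> D x -> D `<=` Fatou h -> ~ basin h rho x ->
  (forall n, complex.Re (iter n h x) < a n < complex.Re (iter n.+1 h x)) ->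
  (forall n z, complex.Re z = a n -> basin h rho z) ->
  lies_in_wandering h D.
Proof.
move=> [oD cD _] Dx DF nbx xa linea.
pose U := connected_component (Fatou h) x.
have FU : component_of (Fatou h) U by exists x => //; exact: DF.
have DU : D `<=` U by exact: connected_component_max.
have Ux : U x by exact: DU.
exists U; split => //.
have comp_x n : Fatou_component_iter h U n !=set0 ->
    component_of (Fatou h) (Fatou_component_iter h U n) /\
    Fatou_component_iter h U n (iter n h x).
  rewrite /Fatou_component_iter; case: xgetP => [V _ [FV UV] _|_ []//].
  by split => //; apply: UV; exists x.
have mono : forall m n, (m < n)%N ->
    complex.Re (iter m h x) < a m < complex.Re (iter n h x).
  have step n : complex.Re (iter n h x) < complex.Re (iter n.+1 h x).
    by have /andP[h1 h2] := xa n; exact: lt_trans h2.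
  have incr : {homo (fun k => complex.Re (iter k h x)) : m n / (m < n)%N >-> m < n}.
    by apply: homo_ltn => //; exact: lt_trans.
  move=> m n; have /andP[-> am] := xa m.
  by rewrite leq_eqVlt => /orP[/eqP <- //|/incr]; exact: lt_trans.
have disj m n : (m < n)%N ->
    Fatou_component_iter h U m `&` Fatou_component_iter h U n = set0.
  move=> mn; apply/eqP/negPn/negP => /set0P[w [mw nw]].
  have [[y Fy Vy] Vm] : _ /\ _ := comp_x m (ex_intro _ w mw).
  have [Fn Vn] := comp_x n (ex_intro _ w nw).
  set V := Fatou_component_iter h U m in Vy Vm mw.
  have cV : connected V by rewrite Vy; exact: component_connected.
  have VF : V `<=` Fatou h by rewrite Vy; exact: connected_component_sub.
  have {}Vn : V (iter n h x).
    have [y' Fy' Vy'] := Fn; rewrite Vy' in nw Vn.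
    rewrite Vy; apply: (connected_component_trans (y := w)); first by rewrite -Vy.
    by apply: (connected_component_trans (y := y')) => //; exact: connected_component_sym.
  have /andP[h1 h2] := mono m n mn.
  have [z [Vz Rz]] : exists z, V z /\ complex.Re z = a m.
    have itv : is_interval ((fun z : CC R => complex.Re z) @` V).
      apply/connected_intervalP; apply: connected_continuous_connected => //.
      by apply: continuous_subspaceT; exact: Re_continuous.
    have [] := itv _ _ (ex_intro2 _ _ _ Vm erefl) (ex_intro2 _ _ _ Vn erefl) (a m).
      by rewrite !ltW.
    by move=> z Vz Rz; exists z.
  apply/nbx/(basin_iter m); apply: (connected_Fatou_basin cV VF) => //.
  by exists z; split => //; exact: linea Rz.
move=> k l; case: (ltngtP k l) => // [kl|lk] _; first exact: disj.
by rewrite setIC; exact: disj.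
Qed.

End Contraction.
End Dynamics.

(** * Real bounds and the complex exponential *)

Section RealBounds.
Variable R : realType.
Implicit Types x y : R.

Lemma le_abs_sin y : `|sin y| <= `|y|.
Proof.
wlog y0 : y / 0 < y => [H|].
  have [y0|y0|<-] := ltgtP 0 y; first exact: H.
    by rewrite -normrN -sinN -(normrN y); apply: H; rewrite oppr_gt0.
  by rewrite sin0 normr0.
have [|c _] := @MVT R sin cos 0 y y0 (fun x _ => is_derive_sin x).
- by apply: continuous_subspaceT => x; exact: continuous_sin.
rewrite sin0 !subr0 => ->.
by rewrite normrM ler_piMl // ler_norml cos_geN1 cos_le1.
Qed.

Lemma le_abs_cosB1 y : `|cos y - 1| <= y ^+ 2.
Proof.
wlog y0 : y / 0 < y => [H|].
  have [y0|y0|<-] := ltgtP 0 y; first exact: H.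
    by rewrite -cosN -sqrrN; apply: H; rewrite oppr_gt0.
  by rewrite cos0 subrr normr0 sqr_ge0.
have [|c cI] := @MVT R cos (fun x => - sin x) 0 y y0 (fun x _ => is_derive_cos x).
- by apply: continuous_subspaceT => x; exact: continuous_cos.
move: cI; rewrite in_itv /= => /andP[c0 cy]; rewrite cos0 !subr0 => ->.
rewrite normrM normrN expr2 (gtr0_norm y0) ler_wpM2r //; first exact: ltW.
by rewrite (le_trans (le_abs_sin _)) // (gtr0_norm c0) ltW.
Qed.

Lemma le_abs_sinB y : `|y| <= 1 -> `|sin y - y| <= y ^+ 2.
Proof.
wlog y0 : y / 0 < y => [H|].
  have [y0|y0|<-] := ltgtP 0 y; first exact: H.
    move=> y1; have -> : sin y - y = - (sin (- y) - (- y)) by rewrite sinN; ring.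
    rewrite normrN -sqrrN; apply: H; last by rewrite normrN.
    by rewrite oppr_gt0.
  by rewrite sin0 subrr normr0 sqr_ge0.
rewrite (gtr0_norm y0) => y1.
have dB x : x \in `]0, y[ -> is_derive x 1 (fun x => sin x - x) (cos x - 1).
  by move=> _; exact: is_deriveB.
have [|c cI] := @MVT R (fun x => sin x - x) (fun x => cos x - 1) 0 y y0 dB.
- apply: continuous_subspaceT => x; apply: cvgB; last exact: cvg_id.
  exact: continuous_sin.
move: cI; rewrite in_itv /= => /andP[c0 cy]; rewrite sin0 !subr0 => ->.
rewrite normrM (gtr0_norm y0) expr2 ler_wpM2r //; first exact: ltW.
apply: (le_trans (le_abs_cosB1 _)); nra.
Qed.

Lemma expR_le_inv x : x < 1 -> expR x <= (1 - x)^-1.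
Proof.
move=> x1; rewrite -[x]opprK expRN lef_pV2 ?posrE ?expR_gt0 ?opprK ?subr_gt0 //.
exact: expR_ge1Dx.
Qed.

Lemma le_abs_expRB x : `|x| <= 1 / 2 -> `|expR x - 1 - x| <= 2 * x ^+ 2.
Proof.
rewrite ler_norml => /andP[h1 h2].
have := expR_ge1Dx x; have := @expR_le_inv x.
move=> /(_ ltac:(lra)) up lo; rewrite ger0_norm; last lra.
have : (1 - x)^-1 <= 1 + x + 2 * x ^+ 2.
  rewrite -[_^-1]mul1r ler_pdivrMr; [nra|lra].
lra.
Qed.

Lemma le_expR2 x : `|x| <= 1 / 2 -> expR x <= 2.
Proof.
rewrite ler_norml => /andP[h1 h2].
apply: (le_trans (expR_le_inv _)); first lra.
rewrite -[_^-1]mul1r ler_pdivrMr; lra.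
Qed.
End RealBounds.

Section ComplexExp.
Variable R : realType.
Implicit Types z w : CC R.

Definition cexp (z : CC R) : CC R :=
  Complex (expR (complex.Re z) * cos (complex.Im z))
          (expR (complex.Re z) * sin (complex.Im z)).

Lemma cexpD z w : cexp (z + w) = cexp z * cexp w.
Proof.
case: z w => [a b] [c d]; rewrite /cexp /=; apply/eqP.
by rewrite eq_complex /= expRD cosD sinD; apply/andP; split; apply/eqP; ring.
Qed.

Lemma cexp0 : cexp 0 = 1.
Proof. by rewrite /cexp /= expR0 cos0 sin0 mulr1 mulr0. Qed.

Lemma cexpNr z : cexp z * cexp (- z) = 1.
Proof. by rewrite -cexpD subrr cexp0. Qed.

Lemma cabs_cexp z : cabs (cexp z) = expR (complex.Re z).
Proof.
rewrite /cabs /cexp /= !exprMn -mulrDr cos2Dsin2 mulr1.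
by rewrite sqrtr_sqr ger0_norm // expR_ge0.
Qed.

(** This bound yields the complex derivative of [cexp] as well as the explicit
Taylor estimates for sine and cosine. *)
Lemma cexp_second_order z : cabs z <= 1 / 2 ->
  cabs (cexp z - 1 - z) <= 8 * cabs z ^+ 2.
Proof.
move=> z2; apply: (le_trans (cabs_le_ReIm _)).
have := le_trans (Re_le_cabs z) z2; have := le_trans (Im_le_cabs z) z2.
have := Re_le_cabs z; have := Im_le_cabs z.
case: z {z2} => x y; set m := cabs _ => /=; rewrite oppr0 addr0 => ym xm y2 x2.
have m0 : 0 <= m by exact: cabs_ge0.
have h1 := le_abs_expRB x2; have h2 := le_expR2 x2.
have h3 := le_abs_cosB1 y; have h4 := @le_abs_sinB _ y ltac:(lra).
have e0 := expR_gt0 x.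
have y2m : y ^+ 2 <= m ^+ 2 by rewrite -real_normK ?num_real // lerXn2r ?nnegrE.
have x2m : x ^+ 2 <= m ^+ 2 by rewrite -real_normK ?num_real // lerXn2r ?nnegrE.
have -> : expR x * cos y - 1 - x = (expR x - 1 - x) + expR x * (cos y - 1) by ring.
have -> : expR x * sin y - y = expR x * (sin y - y) + (expR x - 1 - x) * y + x * y.
  by ring.
have b1 : `|expR x * (cos y - 1)| <= 2 * m ^+ 2.
  rewrite normrM (gtr0_norm e0); apply: ler_pM => //; lra.
have b2 : `|expR x * (sin y - y)| <= 2 * m ^+ 2.
  rewrite normrM (gtr0_norm e0); apply: ler_pM => //; lra.
have b3 : `|x * y| <= m ^+ 2 by rewrite normrM expr2; apply: ler_pM.
have b4 : `|(expR x - 1 - x) * y| <= m ^+ 2.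
  rewrite normrM; apply: (@le_trans _ _ ((2 * m ^+ 2) * (1 / 2))); last lra.
  by apply: ler_pM => //; lra.
have t1 := ler_normD (expR x - 1 - x) (expR x * (cos y - 1)).
have t2 := ler_normD (expR x * (sin y - y) + (expR x - 1 - x) * y) (x * y).
have t3 := ler_normD (expR x * (sin y - y)) ((expR x - 1 - x) * y).
lra.
Qed.

Lemma cexp_first_order z : cabs z <= 1 / 2 -> cabs (cexp z - 1) <= 5 * cabs z.
Proof.
move=> z2; have h := cexp_second_order z2; have z0 := cabs_ge0 z.
have := cabsD (cexp z - 1 - z) z; rewrite subrK; nra.
Qed.

Lemma derivable_cexp z : derivable cexp z 1.
Proof.
apply/cvg_ex; exists (cexp z).
apply/cvgrPdist_lt => e e0.
have /complex_realP[r er] : e \is Num.real by apply: gtr0_real.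
subst e.
have {e0} r0 : 0 < r by rewrite -ltcR.
have E0 := expR_gt0 (complex.Re z); set E := expR _ in E0.
have d0 : 0 < Num.min (1 / 2) (r / (9 * E)) :> R.
  rewrite lt_min; apply/andP; split; first lra.
  by rewrite divr_gt0 // mulr_gt0.
apply/nbhs_cabsP; exists (Num.min (1 / 2) (r / (9 * E))) => // w.
rewrite subr0 lt_min => /andP[w2 wr] /= wn0.
rewrite cabsE ltcR /=.
have wpos : 0 < cabs w.
  by rewrite lt_neqAle cabs_ge0 andbT eq_sym; apply: contra wn0 => /eqP/cabs_eq0 ->.
have -> : cexp z - w^-1 *: (cexp (w *: (1 : CC R) + z) - cexp z) =
    - (w^-1 * cexp z * (cexp w - 1 - w)).
  have -> : w *: (1 : CC R) = w by exact: mulr1.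
  rewrite cexpD.
  have -> : w^-1 *: (cexp w * cexp z - cexp z) = w^-1 * (cexp w * cexp z - cexp z) by [].
  have ww : w^-1 * w = 1 by rewrite mulVf.
  have -> : - (w^-1 * cexp z * (cexp w - 1 - w)) =
     (w^-1 * w) * cexp z - w^-1 * (cexp w * cexp z - cexp z) by ring.
  by rewrite ww mul1r.
rewrite cabsN !cabsM cabs_cexp cabsV -/E.
apply: (@le_lt_trans _ _ ((cabs w)^-1 * E * (8 * cabs w ^+ 2))).
  rewrite ler_wpM2l ?mulr_ge0 ?invr_ge0 ?(ltW wpos) ?(ltW E0) //.
  by apply: cexp_second_order; exact: ltW.
have -> : (cabs w)^-1 * E * (8 * cabs w ^+ 2) = 8 * (E * cabs w).
  by field; rewrite gt_eqF.
move: wr; rewrite ltr_pdivlMr ?mulr_gt0 // => wr.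
have := mulr_gt0 E0 wpos; lra.
Qed.
End ComplexExp.

(** * Closure properties of entire functions *)

Section Entire.
Variable R : realType.
Implicit Types (z w : CC R) (h : CC R -> CC R).

Lemma entire_differentiable h : entire h <-> forall z, differentiable h z.
Proof. by split=> H z; apply/derivable1_diffP; exact: H. Qed.

Lemma entireD h1 h2 : entire h1 -> entire h2 -> entire (fun z => h1 z + h2 z).
Proof. by move=> H1 H2 z; apply: derivableD; [exact: H1|exact: H2]. Qed.

Lemma entireB h1 h2 : entire h1 -> entire h2 -> entire (fun z => h1 z - h2 z).
Proof. by move=> H1 H2 z; apply: derivableB; [exact: H1|exact: H2]. Qed.

Lemma entireM h1 h2 : entire h1 -> entire h2 -> entire (fun z => h1 z * h2 z).
Proof. by move=> H1 H2 z; apply: derivableM; [exact: H1|exact: H2]. Qed.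

Lemma entire_cst c : entire (fun=> c : CC R).
Proof. by move=> z; exact: derivable_cst. Qed.

Lemma entire_id : entire (fun z : CC R => z).
Proof. by move=> z; exact: derivable_id. Qed.

Lemma entire_comp h1 h2 : entire h1 -> entire h2 -> entire (fun z => h1 (h2 z)).
Proof.
move=> /entire_differentiable H1 /entire_differentiable H2.
apply/entire_differentiable => z; apply: (@differentiable_comp _ _ _ _ h2 h1).
- exact: H2.
- exact: H1.
Qed.

Lemma entire_continuous h : entire h -> continuous h.
Proof.
by move=> /entire_differentiable H z; apply: differentiable_continuous; exact: H.
Qed.

End Entire.

(** * Sine and cosine of pi z *)

Section Trig.
Variable R : realType.
Implicit Types (z w : CC R).

Definition iunit : CC R := 'i%C.
Definition piC : CC R := (pi%:C)%C.

Lemma sqr_iunit : iunit * iunit = -1. Proof. by rewrite -expr2; exact: sqr_i. Qed.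

Lemma iunit_neq0 : iunit != 0.
Proof. by rewrite eq_complex /= oner_eq0 andbF. Qed.

Lemma piC_neq0 : piC != 0.
Proof. by rewrite eq_complex /= gt_eqF ?pi_gt0. Qed.

Definition csinpi z : CC R :=
  (cexp (iunit * piC * z) - cexp (- (iunit * piC * z))) / (2 * iunit).
Definition ccospi z : CC R :=
  (cexp (iunit * piC * z) + cexp (- (iunit * piC * z))) / 2.

Lemma ccos2Dcsin2 z : ccospi z ^+ 2 + csinpi z ^+ 2 = 1.
Proof.
rewrite /ccospi /csinpi; have := cexpNr (iunit * piC * z).
set a := cexp _; set b := cexp _ => ab.
have -> : ((a + b) / 2) ^+ 2 + ((a - b) / (2 * iunit)) ^+ 2 =
   ((a + b) ^+ 2 * (iunit * iunit) + (a - b) ^+ 2) / (4 * (iunit * iunit)).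
  by field; exact: iunit_neq0.
rewrite sqr_iunit.
have -> : (a + b) ^+ 2 * -1 + (a - b) ^+ 2 = 4 * -1 * (a * b) by ring.
by rewrite ab mulr1 mulfV // mulf_neq0 ?oppr_eq0 ?oner_eq0 // pnatr_eq0.
Qed.

Lemma csinpiD z w : csinpi (z + w) = csinpi z * ccospi w + ccospi z * csinpi w.
Proof.
rewrite /csinpi /ccospi mulrDr opprD !cexpD.
by field; exact: iunit_neq0.
Qed.

Lemma ccospiD z w : ccospi (z + w) = ccospi z * ccospi w - csinpi z * csinpi w.
Proof.
rewrite /csinpi /ccospi mulrDr opprD !cexpD.
set a := cexp _; set b := cexp _; set c := cexp _; set d := cexp _.
have -> : (a + c) / 2 * ((b + d) / 2) - (a - c) / (2 * iunit) * ((b - d) / (2 * iunit)) =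
   ((a + c) * (b + d) * (iunit * iunit) - (a - c) * (b - d)) / (4 * (iunit * iunit)).
  by field; exact: iunit_neq0.
by rewrite sqr_iunit; field.
Qed.

Lemma cexp_imag (t : R) : cexp (iunit * (t%:C)%C) = Complex (cos t) (sin t).
Proof.
rewrite /cexp.
have -> : complex.Re (iunit * (t%:C)%C) = 0 by rewrite /= !mul0r mul1r subr0.
have -> : complex.Im (iunit * (t%:C)%C) = t by rewrite /= mul0r mul1r add0r.
by rewrite expR0 !mul1r.
Qed.

Lemma cexp_real (t : R) : cexp (t%:C)%C = ((expR t)%:C)%C.
Proof. by rewrite /cexp /= cos0 sin0 mulr1 mulr0. Qed.

Lemma csinpi_real (t : R) : csinpi (t%:C)%C = ((sin (pi * t))%:C)%C.
Proof.
rewrite /csinpi -mulrA -rmorphM -mulrN -rmorphN !cexp_imag sinN cosN.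
rewrite [X in X / _](_ : _ = 2 * iunit * ((sin (pi * t))%:C)%C).
  by field; exact: iunit_neq0.
by apply/eqP; rewrite eq_complex /=; apply/andP; split; apply/eqP; ring.
Qed.

Lemma ccospi_real (t : R) : ccospi (t%:C)%C = ((cos (pi * t))%:C)%C.
Proof.
rewrite /ccospi -mulrA -rmorphM -mulrN -rmorphN !cexp_imag sinN cosN.
rewrite [X in X / _](_ : _ = 2 * ((cos (pi * t))%:C)%C).
  by field.
by apply/eqP; rewrite eq_complex /=; apply/andP; split; apply/eqP; ring.
Qed.

Lemma csinpi_nat n : csinpi n%:R = 0.
Proof.
elim: n => [|n IH].
  by rewrite (_ : 0%:R = ((0 : R)%:C)%C :> CC R) // csinpi_real mulr0 sin0.
rewrite -natr1 csinpiD IH (_ : 1 = ((1 : R)%:C)%C :> CC R) // csinpi_real.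
by rewrite mulr1 sinpi mul0r mulr0 addr0.
Qed.

Lemma ccospi_nat n : ccospi n%:R = (-1) ^+ n.
Proof.
elim: n => [|n IH].
  by rewrite (_ : 0%:R = ((0 : R)%:C)%C :> CC R) // ccospi_real mulr0 cos0.
rewrite -natr1 ccospiD IH csinpi_nat (_ : 1 = ((1 : R)%:C)%C :> CC R) // ccospi_real.
by rewrite mulr1 cospi mul0r subr0 rmorphN1 exprSr.
Qed.

Definition half_odd (n : nat) : CC R := n%:R + 2^-1.

Lemma half_real : (2^-1 : CC R) = ((2^-1 : R)%:C)%C.
Proof. by rewrite fmorphV rmorph_nat. Qed.

Lemma csinpi_half_odd n w : csinpi (half_odd n + w) = (-1) ^+ n * ccospi w.
Proof.
rewrite /half_odd -addrA csinpiD csinpi_nat mul0r add0r ccospi_nat csinpiD half_real.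
by rewrite csinpi_real ccospi_real sin_pihalf cos_pihalf mul0r addr0 mul1r.
Qed.

Lemma ccospi_half_odd n w : ccospi (half_odd n + w) = - ((-1) ^+ n * csinpi w).
Proof.
rewrite /half_odd -addrA ccospiD csinpi_nat mul0r subr0 ccospi_nat ccospiD half_real.
by rewrite csinpi_real ccospi_real sin_pihalf cos_pihalf mul0r sub0r mul1r mulrN.
Qed.

Lemma cabs_iunit : cabs iunit = 1.
Proof. by rewrite /cabs /= expr0n expr1n /= add0r sqrtr1. Qed.

Lemma cabs_piC : cabs piC = pi.
Proof. by rewrite cabs_real ger0_norm // pi_ge0. Qed.

Lemma cabs_pi z : cabs (iunit * piC * z) = pi * cabs z.
Proof. by rewrite !cabsM cabs_iunit mul1r cabs_real ger0_norm // pi_ge0. Qed.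

Lemma cabs_nat n : cabs (n%:R : CC R) = n%:R.
Proof. by rewrite -(rmorph_nat (@real_complex_def R (Phant R))) cabs_real ger0_norm. Qed.

Lemma pi_lt4 : pi < 4 :> R.
Proof. have := pihalf_lt2 R; rewrite ltr_pdivrMr //; lra. Qed.

Section Small.
Variable z : CC R.
Hypothesis z8 : cabs z <= 1 / 8.

Let pz : cabs (iunit * piC * z) <= 1 / 2.
Proof.
have := z8; rewrite cabs_pi; have := pi_lt4; have := pi_gt0 R; have := cabs_ge0 z.
move: (pi : R) (cabs z) => p m; nra.
Qed.

Let pi2 : pi ^+ 2 <= 16 :> R.
Proof. by have := pi_lt4; have := pi_gt0 R; move: (pi : R) => p; nra. Qed.

Lemma csinpi_small : cabs (csinpi z - piC * z) <= 128 * cabs z ^+ 2.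
Proof.
rewrite /csinpi; have h1 := cexp_second_order pz.
have := @cexp_second_order _ (- (iunit * piC * z)); rewrite cabsN => /(_ pz) h2.
rewrite cabs_pi in h1 h2.
set w := iunit * piC * z in h1 h2 *.
have -> : (cexp w - cexp (- w)) / (2 * iunit) - piC * z =
   ((cexp w - 1 - w) - (cexp (- w) - 1 - - w)) / (2 * iunit).
  by rewrite /w; field; exact: iunit_neq0.
rewrite cabsM cabsV cabsM cabs_iunit mulr1 (cabs_nat 2).
rewrite ler_pdivrMr //; apply: (le_trans (cabsB _ _)).
rewrite exprMn in h1 h2; have := ler_wpM2r (sqr_ge0 (cabs z)) pi2; lra.
Qed.

Lemma ccospi_small : cabs (ccospi z - 1) <= 128 * cabs z ^+ 2.
Proof.
rewrite /ccospi; have h1 := cexp_second_order pz.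
have := @cexp_second_order _ (- (iunit * piC * z)); rewrite cabsN => /(_ pz) h2.
rewrite cabs_pi in h1 h2.
set w := iunit * piC * z in h1 h2 *.
have -> : (cexp w + cexp (- w)) / 2 - 1 =
   ((cexp w - 1 - w) + (cexp (- w) - 1 - - w)) / 2.
  by field.
rewrite cabsM cabsV (cabs_nat 2).
rewrite ler_pdivrMr //; apply: (le_trans (cabsD _ _)).
rewrite exprMn in h1 h2; have := ler_wpM2r (sqr_ge0 (cabs z)) pi2; lra.
Qed.

Lemma csinpi_lin : cabs (csinpi z) <= 20 * cabs z.
Proof.
have := csinpi_small; have := cabsD (csinpi z - piC * z) (piC * z).
rewrite subrK cabsM cabs_real ger0_norm ?pi_ge0 //.
have := z8; have := pi_lt4; have := cabs_ge0 z; move: (pi : R) (cabs z) => p m; nra.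
Qed.
End Small.

Lemma ccospi_imag (y : R) : ccospi (iunit * (y%:C)%C) =
  (((expR (pi * y) + expR (- (pi * y))) / 2)%:C)%C.
Proof.
rewrite /ccospi; have -> : iunit * piC * (iunit * (y%:C)%C) = ((- (pi * y))%:C)%C.
  rewrite rmorphN rmorphM /piC.
  have -> : iunit * (pi%:C)%C * (iunit * (y%:C)%C) = (iunit * iunit) * ((pi%:C)%C * (y%:C)%C) by ring.
  by rewrite sqr_iunit mulN1r.
rewrite -rmorphN opprK !cexp_real addrC -rmorphD rmorphM fmorphV.
by rewrite rmorph_nat.
Qed.
End Trig.

(** * The model functions *)

Section Model.
Variable R : realType.
Implicit Types (s z w : CC R).

(** The double zero of [v^2] makes [damping] equal to [1] up to a second-order
error near the half-odd integers.  On the lines [Re z = n] one has [v^2 >= 1 + (Im z)^2],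
which compensates the negative part of [z^2] and leaves an exponent of real part
at most [- 100 v^2 (n^2 + 1)].  The constant [100] is chosen so that the lines go
into the disc of radius [1/128] ([model_line]) and this disc is contracted
([contracts_model]). *)
Definition damping z : CC R :=
  cexp (- (100 * (ccospi z ^+ 2 * (z ^+ 2 + ccospi z ^+ 2)))).

(** The correction [u v / pi] cancels the derivative of [z + 1] at the half-odd
integers. *)
Definition shift1 z : CC R := z + 1 + csinpi z * ccospi z / piC R.

(** For [s = 1] or [s = -1] the factor [u (u + s) / 2] is [1] at the points
[n + 1/2] with [(-1)^n = s] and [0] at the other ones; being a polynomial in [u],
it is stationary at all of them.  Its zero at [u = 0] makes the integers zeros
of the model. *)
Definition model s z : CC R :=
  csinpi z * (csinpi z + s) / 2 * shift1 z * damping z.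

Lemma entire_model s : entire (model s).
Proof.
have ec a : entire (fun z : CC R => cexp (a * z)).
  apply: (@entire_comp _ (@cexp R) (fun z => a * z)).
    by move=> z; exact: derivable_cexp.
  by apply: entireM; [exact: entire_cst|exact: entire_id].
have ecN : entire (fun z : CC R => cexp (- (iunit R * piC R * z))).
  rewrite (_ : (fun z => _) = (fun z => cexp (- (iunit R * piC R) * z))); last first.
    by apply/funext => w; rewrite mulNr.
  exact: ec.
have es : entire (@csinpi R).
  exact: (entireM (entireB (ec (iunit R * piC R)) ecN) (@entire_cst R (2 * iunit R)^-1)).
have ek : entire (@ccospi R).
  exact: (entireM (entireD (ec (iunit R * piC R)) ecN) (@entire_cst R 2^-1)).
have ek2 : entire (fun z : CC R => ccospi z ^+ 2).
  have -> : (fun z : CC R => ccospi z ^+ 2) = (fun z => ccospi z * ccospi z).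
    by apply/funext => z; rewrite expr2.
  exact: entireM.
have ez2 : entire (fun z : CC R => z ^+ 2).
  have -> : (fun z : CC R => z ^+ 2) = (fun z => z * z).
    by apply/funext => z; rewrite expr2.
  by apply: entireM; exact: entire_id.
have ed : entire damping.
  rewrite (_ : damping = fun z =>
      cexp (- 100 * (ccospi z ^+ 2 * (z ^+ 2 + ccospi z ^+ 2)))); last first.
    by apply/funext => z; rewrite /damping mulNr.
  exact: (@entire_comp _ (fun z => cexp (- 100 * z)) _ (ec _)
            (entireM ek2 (entireD ez2 ek2))).
have esh : entire shift1.
  exact: (entireD (entireD (@entire_id R) (@entire_cst R 1))
            (entireM (entireM es ek) (@entire_cst R (piC R)^-1))).
exact: (entireM (entireM (entireM (entireM es (entireD es (@entire_cst R s)))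
            (@entire_cst R 2^-1)) esh) ed).
Qed.

Lemma cabs_shift1 z : cabs (shift1 z) <= cabs z + 1 + cabs (csinpi z) * cabs (ccospi z).
Proof.
apply: (le_trans (cabsD _ _)); apply: lerD.
  by apply: (le_trans (cabsD _ _)); rewrite cabs1.
rewrite cabsM (cabsM (csinpi z)) cabsV cabs_piC.
rewrite ler_pdivrMr ?pi_gt0 // ler_peMr ?mulr_ge0 ?cabs_ge0 //.
have := pi_ge2 R; lra.
Qed.

(** With [t = pi y] the difference [cosh t ^ 2 - 1] is [sinh t ^ 2], and
[sinh t >= t / 2 >= y] because [pi >= 2]. *)
Lemma cosh_ge (y : R) :
  1 + y ^+ 2 <= ((expR (pi * y) + expR (- (pi * y))) / 2) ^+ 2.
Proof.
wlog y0 : y / 0 <= y => [H|].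
  have [/H //|/ltW y0] := leP 0 y.
  have := H (- y); rewrite mulrN opprK sqrrN addrC [X in X / 2]addrC; apply.
  by rewrite oppr_ge0.
set t := pi * y; have t0 : 0 <= t by rewrite mulr_ge0 ?pi_ge0.
have h1 := expR_ge1Dx t; have h2 : expR (- t) <= 1 by rewrite -expR0 ler_expR oppr_le0.
have h3 : expR t * expR (- t) = 1 by rewrite -expRD subrr expR0.
have h4 : 2 * y <= t by rewrite ler_wpM2r // pi_ge2.
have -> : ((expR t + expR (- t)) / 2) ^+ 2 =
   expR t * expR (- t) + ((expR t - expR (- t)) / 2) ^+ 2 by field.
rewrite h3 lerD2l; apply: lerXn2r; rewrite ?nnegrE //; lra.
Qed.

(** On the line [Re z = n] put [c = v^2 >= 1] and [W = c (n^2 + 1)].  The first two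
factors are at most [c] and [4 W], the damping at most [exp (- 100 W)], which
outweighs [4 W^2] because [exp t >= t^3 / 6]. *)
Lemma model_line s z n : cabs s <= 1 -> complex.Re z = n%:R ->
  disc 0 (1 / 128) (model s z).
Proof.
move=> s1 zn; rewrite /disc /= subr0.
set y := complex.Im z.
have zE : z = n%:R + 'i%C * (y%:C)%C.
  by rewrite [LHS]complexE zn rmorph_nat.
pose C : R := (expR (pi * y) + expR (- (pi * y))) / 2.
pose c : R := C ^+ 2.
have vE : ccospi z ^+ 2 = (c%:C)%C.
  rewrite zE ccospiD csinpi_nat mul0r subr0 ccospi_nat ccospi_imag exprMn.
  by rewrite -exprM mulnC exprM sqrrN !expr1n mul1r /c rmorphXn.
have c1 : 1 + y ^+ 2 <= c by exact: cosh_ge.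
have y2 := sqr_ge0 y.
have vv : cabs (ccospi z) ^+ 2 = c.
  by rewrite -cabsX vE cabs_real ger0_norm //; lra.
have uu : cabs (csinpi z) ^+ 2 = c - 1.
  have := ccos2Dcsin2 z; rewrite vE => /(congr1 (fun x => x - (c%:C)%C)).
  rewrite addrC addKr -cabsX => ->.
  have -> : 1 - (c%:C)%C = ((1 - c)%:C)%C :> CC R by rewrite rmorphB.
  by rewrite cabs_real ler0_norm ?opprB //; lra.
have zz : cabs z <= n%:R + `|y|.
  by apply: (le_trans (cabs_le_ReIm _)); rewrite zn ger0_norm.
have dE : cabs (damping z) = expR (- (100 * (c * (n%:R ^+ 2 - y ^+ 2 + c)))).
  rewrite cabs_cexp vE; congr expR.
  have -> : z = Complex n%:R y by rewrite -zn /y; case: (z).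
  have -> : (100 : CC R) = ((100 : R)%:C)%C by rewrite rmorph_nat.
  by rewrite expr2 /=; ring.
set u := cabs (csinpi z) in uu; set v := cabs (ccospi z) in vv.
have u0 : 0 <= u by exact: cabs_ge0.
have v0 : 0 <= v by exact: cabs_ge0.
pose m : R := n%:R; have m0 : 0 <= m by exact: ler0n.
pose W := c * (m ^+ 2 + 1).
have cW : c <= W by rewrite /W ler_peMr; nra.
have W1 : 1 <= W by lra.
have uc : u <= c by nra.
have uvc : u * v <= c by nra.
have yc : `|y| <= c.
  have := real_normK (num_real y); have := normr_ge0 y; nra.
have b1 : cabs (csinpi z * (csinpi z + s) / 2) <= c.
  rewrite cabsM cabsM cabsV (cabs_nat _ 2) ler_pdivrMr // -/u.
  have : cabs (csinpi z + s) <= u + 1 by apply: (le_trans (cabsD _ _)); rewrite lerD2l.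
  move=> /(ler_wpM2l u0); nra.
have mW : m ^+ 2 + 1 <= W by rewrite /W ler_peMl; nra.
have b2 : cabs (shift1 z) <= 4 * W.
  apply: (le_trans (cabs_shift1 _)); rewrite -/u -/v.
  have : m <= m ^+ 2 + 1 by nra.
  rewrite -/m in zz; lra.
have b3 : cabs (damping z) <= expR (- (100 * W)).
  rewrite dE ler_expR lerN2 -/m /W; nra.
have b4 : expR (- (100 * W)) * (4 * W ^+ 2) < 1 / 128.
  rewrite expRN mulrC ltr_pdivrMr ?expR_gt0 //.
  have /(@expR_ge1Dxn R _ 2) : 0 <= 100 * W by lra.
  have -> : (3`!)%:R = 6 :> R by [].
  have W2 : 1 <= W ^+ 2 by nra.
  have W3 : W ^+ 2 <= W ^+ 3 by rewrite exprSr; nra.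
  rewrite exprMn; lra.
rewrite /model cabsM cabsM; apply: le_lt_trans b4.
rewrite mulrC; apply: ler_pM => //; rewrite ?mulr_ge0 ?cabs_ge0 //.
apply: (@le_trans _ _ (c * (4 * W))); last by nra.
by apply: ler_pM; rewrite ?cabs_ge0.
Qed.
End Model.

(** * Local behaviour at 0 and at half-odd integers *)

Section Local.
Variable R : realType.
Implicit Types (s z w : CC R).

(** Near [0] the model is at most [12 |z|] times [2] times the damping, and the
exponent of the damping is close to [- 100]. *)
Lemma contracts_model s : cabs s <= 1 -> contracts (model s) (1 / 128).
Proof.
move=> s1; split => [||z].
- exact: (@entire_continuous R (model s) (@entire_model R s)).
- by rewrite divr_gt0.
rewrite /disc /= subr0; set m := cabs z => m128.
have m0 : 0 <= m by exact: cabs_ge0.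
have m8 : m <= 1 / 8 by lra.
have u20 := csinpi_lin m8; have v1 := ccospi_small m8.
have mm : m ^+ 2 <= 1 / 128 / 128 by nra.
have vle : cabs (ccospi z) <= 101 / 100.
  have := cabsD (ccospi z - 1) 1; rewrite subrK cabs1 -/m in v1 *; lra.
set u := cabs (csinpi z) in u20; rewrite -/m in u20 v1.
have u0 : 0 <= u by exact: cabs_ge0.
have b3 : cabs (damping z) <= 51^-1.
  rewrite cabs_cexp.
  set X := ccospi z ^+ 2 * (z ^+ 2 + ccospi z ^+ 2).
  (* In terms of q = v^2 - 1 = - u^2, which is small, X is close to 1. *)
  set q : CC R := - csinpi z ^+ 2.
  have qE : ccospi z ^+ 2 = 1 + q by rewrite -(ccos2Dcsin2 z) addrK.
  have q400 : cabs q <= 400 * m ^+ 2.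
    have -> : 400 * m ^+ 2 = (20 * m) ^+ 2 by ring.
    by rewrite cabsN cabsX -/u; apply: lerXn2r; rewrite ?nnegrE //; lra.
  have X1 : cabs (X - 1) <= 1 / 2.
    have -> : X - 1 = z ^+ 2 + (q * z ^+ 2 + (q + (q + q ^+ 2))) by rewrite /X qE; ring.
    have t1 := cabsD (z ^+ 2) (q * z ^+ 2 + (q + (q + q ^+ 2))).
    have t2 := cabsD (q * z ^+ 2) (q + (q + q ^+ 2)).
    have t3 := cabsD q (q + q ^+ 2); have t4 := cabsD q (q ^+ 2).
    rewrite cabsM !cabsX -/m in t1 t2 t3 t4.
    have q0 := cabs_ge0 q; have : cabs q <= 1 / 40 by lra.
    nra.
  have ReX : 1 / 2 <= complex.Re X.
    have := Re_le_cabs (X - 1); rewrite raddfB /= ler_norml => /andP[h _].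
    lra.
  have -> : complex.Re (- (100 * X)) = - (100 * complex.Re X).
    have -> : (100 : CC R) = ((100 : R)%:C)%C by rewrite rmorph_nat.
    by case: (X) => x y /=; rewrite mul0r subr0.
  rewrite expRN lef_pV2 ?posrE ?expR_gt0 //.
  have := expR_ge1Dx (100 * complex.Re X); lra.
have b2 : cabs (shift1 z) <= 2.
  apply: (le_trans (cabs_shift1 _)); rewrite -/u -/m; nra.
have b1 : cabs (csinpi z * (csinpi z + s) / 2) <= 12 * m.
  rewrite cabsM cabsM cabsV (cabs_nat _ 2) ler_pdivrMr // -/u.
  have : cabs (csinpi z + s) <= 6 / 5 by apply: (le_trans (cabsD _ _)); rewrite -/u; lra.
  move=> /(ler_wpM2l u0); nra.
rewrite /model cabsM cabsM.
apply: (@le_trans _ _ (12 * m * 2 * 51^-1)); last lra.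
apply: ler_pM; rewrite ?mulr_ge0 ?cabs_ge0 //.
by apply: ler_pM; rewrite ?cabs_ge0.
Qed.

Section HalfOdd.
Variables (n : nat) (w : CC R).
Let N : R := n.+1%:R.
Let m := cabs w.
Hypothesis wN : 1000 * N * m <= 1.

Let NE : N = n%:R + 1. Proof. by rewrite natr1. Qed.
Let N1 : 1 <= N. Proof. by rewrite ler1n. Qed.
Let m0 : 0 <= m. Proof. exact: cabs_ge0. Qed.
Let m1000 : m <= 1 / 1000.
Proof. by have := wN; have := N1; have := m0; nra. Qed.
Let m8 : m <= 1 / 8. Proof. by have := m1000; lra. Qed.
Let mm : 1000 * m ^+ 2 <= m.
Proof. by have := m0; have := m1000; nra. Qed.
Let Nm2 : 1000 * 1000 * (N ^+ 2 * m ^+ 2) <= 1.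
Proof.
have N0 : 0 <= N * m by have := N1; have := m0; nra.
have := wN; have -> : 1000 * N * m = 1000 * (N * m) by ring.
have -> : N ^+ 2 * m ^+ 2 = (N * m) ^+ 2 by ring.
by move: (N * m) N0 => t; nra.
Qed.

Lemma damping_half_odd :
  cabs (damping (half_odd R n + w) - 1) <= 400 * 1000 * (N ^+ 2 * m ^+ 2) /\
  cabs (damping (half_odd R n + w)) <= 2.
Proof.
have M0 := m0; have NM := Nm2; have N1' := N1; have M1 := m1000.
have u20 := csinpi_lin m8; rewrite -/m in u20.
set u := cabs (csinpi w) in u20.
have u0 : 0 <= u by exact: cabs_ge0.
have v2 : ccospi (half_odd R n + w) ^+ 2 = csinpi w ^+ 2.
  by rewrite ccospi_half_odd sqrrN exprMn -exprM mulnC exprM sqrrN !expr1n mul1r.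
have aN : cabs (half_odd R n + w) <= N.
  apply: (le_trans (cabsD _ _)); rewrite -/m.
  have : cabs (half_odd R n) <= n%:R + 2^-1.
    by apply: (le_trans (cabsD _ _)); rewrite cabs_nat cabsV (cabs_nat _ 2).
  by have := NE; lra.
rewrite /damping v2.
set z := half_odd R n + w in aN *.
set X := - _.
have Xle : cabs X <= 80 * 1000 * (N ^+ 2 * m ^+ 2).
  rewrite cabsN cabsM (cabs_nat _ 100) cabsM cabsX -/u.
  have uu : u ^+ 2 <= 400 * m ^+ 2.
    have -> : 400 * m ^+ 2 = (20 * m) ^+ 2 by ring.
    by rewrite lerXn2r ?nnegrE // mulr_ge0.
  have : cabs (z ^+ 2 + csinpi w ^+ 2) <= 2 * N ^+ 2.
    apply: (le_trans (cabsD _ _)); rewrite !cabsX -/u.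
    have : cabs z ^+ 2 <= N ^+ 2 by rewrite lerXn2r ?nnegrE ?cabs_ge0 // ler0n.
    have : 1 <= N ^+ 2 by rewrite exprn_ege1.
    have : 400 * m ^+ 2 <= 1 by have := mm; have := m1000; lra.
    lra.
  move=> h; have := ler_pM (sqr_ge0 u) (cabs_ge0 _) uu h; lra.
have X2 : cabs X <= 1 / 2 by lra.
have h := cexp_first_order X2; split; first lra.
have := cabsD (cexp X - 1) 1; rewrite subrK cabs1; lra.
Qed.

Let u_sign := csinpi_half_odd n w.

(** Both [sin (pi w) - pi w] and [cos (pi w) - 1] are of second order. *)
Lemma shift1_half_odd :
  cabs (shift1 (half_odd R n + w) - (half_odd R n + 1)) <= 256 * m ^+ 2.
Proof.
have u20 := csinpi_lin m8; have us := csinpi_small m8; have v1 := ccospi_small m8.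
rewrite -/m in u20 us v1.
have -> : shift1 (half_odd R n + w) - (half_odd R n + 1) =
   - ((csinpi w - piC R * w) + (ccospi w - 1) * csinpi w) / piC R.
  rewrite /shift1 u_sign ccospi_half_odd.
  have -> : (-1) ^+ n * ccospi w * - ((-1) ^+ n * csinpi w) =
     - (((-1) ^+ n * (-1) ^+ n) * (ccospi w * csinpi w)) :> CC R by ring.
  rewrite -exprMn mulrNN mulr1 expr1n mul1r.
  by have := piC_neq0 R; move: (piC R) => p p0; field.
rewrite cabsM cabsN cabsV cabs_piC ler_pdivrMr ?pi_gt0 //.
have t1 := cabsD (csinpi w - piC R * w) ((ccospi w - 1) * csinpi w).
rewrite cabsM in t1.
have t2 := ler_pM (cabs_ge0 _) (cabs_ge0 _) v1 u20.
have p2 := ler_wpM2l (sqr_ge0 m) (pi_ge2 R).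
have M2 := sqr_ge0 m.
have m3 : 128 * m ^+ 2 * (20 * m) <= 128 * m ^+ 2.
  by apply: ler_piMr; [lra|have := m1000; lra].
lra.
Qed.

Let half_odd_le : cabs (half_odd R n + 1) <= 2 * N.
Proof.
apply: (le_trans (cabsD _ _)); rewrite cabs1.
have : cabs (half_odd R n) <= n%:R + 2^-1.
  by apply: (le_trans (cabsD _ _)); rewrite cabs_nat cabsV (cabs_nat _ 2).
by have := NE; have := ler0n R n; lra.
Qed.

Let shift1_le : cabs (shift1 (half_odd R n + w)) <= 3 * N.
Proof.
have := cabsD (shift1 (half_odd R n + w) - (half_odd R n + 1)) (half_odd R n + 1).
rewrite subrK; have := shift1_half_odd; have := half_odd_le.
have := mm; have := m1000; have := N1; lra.
Qed.

Let vle : cabs (ccospi w) <= 2.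
Proof.
have := cabsD (ccospi w - 1) 1; rewrite subrK cabs1.
have := ccospi_small m8; rewrite -/m; have := mm; have := m1000; lra.
Qed.

Let sign2 : (-1) ^+ n * (-1) ^+ n = 1 :> CC R.
Proof. by rewrite -exprMn mulrNN mulr1 expr1n. Qed.

(** The quadratic error in [w] is what makes the orbit of [1/2] attracting; its
constant grows like [N^3], a factor [N^2] coming from [z^2] in the damping and
a factor [N] from the size of the target. *)
Lemma model_wander :
  cabs (model ((-1) ^+ n) (half_odd R n + w) - half_odd R n.+1) <=
  1000 * 1000 * (N ^+ 3 * m ^+ 2).
Proof.
have -> : half_odd R n.+1 = half_odd R n + 1 by rewrite /half_odd -natr1; ring.
have [d1 d2] := damping_half_odd; have k1 := shift1_half_odd.
have v1 := ccospi_small m8; rewrite -/m in v1.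
rewrite /model u_sign.
have -> : (-1) ^+ n * ccospi w * ((-1) ^+ n * ccospi w + (-1) ^+ n) / 2 =
   1 + (ccospi w - 1) * (ccospi w + 2) / 2 :> CC R.
  have -> : (-1) ^+ n * ccospi w * ((-1) ^+ n * ccospi w + (-1) ^+ n) =
     ((-1) ^+ n * (-1) ^+ n) * (ccospi w * (ccospi w + 1)) :> CC R by ring.
  by rewrite sign2; field.
set q := (ccospi w - 1) * _ / _.
have q1 : cabs q <= 256 * m ^+ 2.
  rewrite cabsM cabsM cabsV (cabs_nat _ 2) ler_pdivrMr //.
  have h : cabs (ccospi w + 2) <= 4.
    by apply: (le_trans (cabsD _ _)); rewrite (cabs_nat _ 2); have := vle; lra.
  have := ler_pM (cabs_ge0 _) (cabs_ge0 _) v1 h; lra.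
set S := shift1 _ in k1 *; set d := damping _ in d1 d2 *.
set a := half_odd R n + 1 in k1 *.
have Sle : cabs S <= 3 * N by exact: shift1_le.
have ale : cabs a <= 2 * N by exact: half_odd_le.
clearbody q S d a.
have -> : (1 + q) * S * d - a = q * S * d + ((S - a) * d + a * (d - 1)) by ring.
have t1 := cabsD (q * S * d) ((S - a) * d + a * (d - 1)).
have t2 := cabsD ((S - a) * d) (a * (d - 1)).
rewrite !cabsM in t1 t2.
have e1 := ler_pM (cabs_ge0 _) (cabs_ge0 _) q1 Sle.
have e2 := ler_pM (mulr_ge0 (cabs_ge0 q) (cabs_ge0 S)) (cabs_ge0 _) e1 d2.
have e3 := ler_pM (cabs_ge0 _) (cabs_ge0 _) k1 d2.
have e4 := ler_pM (cabs_ge0 _) (cabs_ge0 _) ale d1.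
have NN : N <= N ^+ 3 by rewrite -[leLHS]expr1 ler_weXn2l.
have M0 := sqr_ge0 m.
have f1 := ler_wpM2r M0 NN.
have f2 : m ^+ 2 <= N ^+ 3 * m ^+ 2 by rewrite ler_peMl //; apply: le_trans NN.
have f3 : 2 * N * (400 * 1000 * (N ^+ 2 * m ^+ 2)) = 800 * 1000 * (N ^+ 3 * m ^+ 2).
  by ring.
lra.
Qed.

(** Here the first factor vanishes at the centre, to second order in [w]. *)
Lemma model_fall : disc 0 (1 / 128) (model (- (-1) ^+ n) (half_odd R n + w)).
Proof.
have [_ d2] := damping_half_odd.
have v1 := ccospi_small m8; rewrite -/m in v1.
rewrite /disc /= subr0 /model u_sign.
have -> : (-1) ^+ n * ccospi w * ((-1) ^+ n * ccospi w + - (-1) ^+ n) / 2 =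
   (ccospi w - 1) * ccospi w / 2 :> CC R.
  have -> : (-1) ^+ n * ccospi w * ((-1) ^+ n * ccospi w + - (-1) ^+ n) =
     ((-1) ^+ n * (-1) ^+ n) * (ccospi w * (ccospi w - 1)) :> CC R by ring.
  by rewrite sign2; ring.
set q := (ccospi w - 1) * _ / _.
have q1 : cabs q <= 128 * m ^+ 2.
  rewrite cabsM cabsM cabsV (cabs_nat _ 2) ler_pdivrMr //.
  have := ler_pM (cabs_ge0 _) (cabs_ge0 _) v1 vle; lra.
rewrite cabsM cabsM.
have e1 := ler_pM (cabs_ge0 _) (cabs_ge0 _) q1 shift1_le.
have e2 := ler_pM (mulr_ge0 (cabs_ge0 q) (cabs_ge0 _)) (cabs_ge0 _) e1 d2.
apply: (le_lt_trans e2).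
have : 1000 * (N * m ^+ 2) <= m by have := wN; have := m0; nra.
have := m1000; lra.
Qed.
End HalfOdd.
End Local.

(** * Orbits under the model functions *)

Section Orbits.
Variable R : realType.
Implicit Types (s z w : CC R).

(** The radii must satisfy [C N^3 r_n^2 <= r_(n+1)] for the constant [C = 1000^2] of
[model_wander], with [N = n + 1].  For [r_n = c / N^3] this reads
[C c <= (N / (N + 1))^3], where the right-hand side is at least [1/8]; hence the
choice [c = 1 / (8 C)]. *)
Definition radius (n : nat) : R := (8 * (1000 * 1000) * n.+1%:R ^+ 3)^-1.

Lemma radius_gt0 n : 0 < radius n.
Proof.
rewrite invr_gt0; apply: mulr_gt0; first lra.
by rewrite exprn_gt0 // ltr0n.
Qed.

Lemma radius_le_half n : radius n <= 1 / 2.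
Proof.
have N3 : 1 <= n.+1%:R ^+ 3 :> R by rewrite exprn_ege1 // ler1n.
rewrite div1r lef_pV2 ?posrE; lra.
Qed.

Lemma radius_small n (m : R) : 0 <= m -> m < radius n -> 1000 * n.+1%:R * m <= 1.
Proof.
move=> m0; rewrite /radius; have : 1 <= n.+1%:R :> R by rewrite ler1n.
move: (n.+1%:R) => N N1.
have N3 : N <= N ^+ 3 by rewrite -[leLHS]expr1 ler_weXn2l.
have P0 : 0 < 8 * (1000 * 1000) * N ^+ 3 by lra.
rewrite -[X in m < X]mul1r ltr_pdivlMr; last exact: P0.
have := ler_wpM2l m0 N3; have := mulr_ge0 m0 (le_trans ler01 N1); lra.
Qed.

Lemma model_chain n z : disc (half_odd R n) (radius n) z ->
  disc (half_odd R n.+1) (radius n.+1) (model ((-1) ^+ n) z).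
Proof.
rewrite /disc /= => zn; have m0 := cabs_ge0 (z - half_odd R n).
have wN := radius_small m0 zn.
have := model_wander wN; rewrite (addrC _ (z - _)) subrK => /le_lt_trans; apply.
move: zn m0; move: (cabs _) => m; rewrite /radius.
have -> : n.+2%:R = n.+1%:R + 1 :> R by rewrite natr1.
have : 1 <= n.+1%:R :> R by rewrite ler1n.
move: (n.+1%:R) => N N1 {wN}.
have N3 : 0 < N ^+ 3 by rewrite exprn_gt0 //; lra.
have M3 : (N + 1) ^+ 3 <= 8 * N ^+ 3.
  have -> : 8 * N ^+ 3 = (2 * N) ^+ 3 by ring.
  by apply: lerXn2r; rewrite ?nnegrE; lra.
have M30 : 0 < (N + 1) ^+ 3 by rewrite exprn_gt0 //; lra.
move: (N ^+ 3) ((N + 1) ^+ 3) N3 M3 M30 => P Q P0 QP Q0.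
have : 0 < (1000 * 1000 : R) by lra.
move: (1000 * 1000 : R) => k k0.
rewrite -[X in m < X]mul1r ltr_pdivlMr ?mulr_gt0 // => mP m0.
rewrite -[X in _ < X]mul1r ltr_pdivlMr ?mulr_gt0 //. have mP0 : 0 <= m * (8 * k * P).
  by rewrite !mulr_ge0 // ltW.
apply: (@le_lt_trans _ _ ((m * (8 * k * P)) ^+ 2)); last by rewrite exprn_ilt1.
have -> : (m * (8 * k * P)) ^+ 2 = k * (P * m ^+ 2) * (8 * k * (8 * P)) by ring.
apply: ler_wpM2l; first by rewrite !mulr_ge0 ?sqr_ge0 // ltW.
by apply: ler_wpM2l => //; rewrite mulr_ge0 // ltW.
Qed.

Lemma model_drop n z : disc (half_odd R n) (radius n) z ->
  disc 0 (1 / 128) (model (- (-1) ^+ n) z).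
Proof.
move=> zn; have m0 := cabs_ge0 (z - half_odd R n).
by have := model_fall (radius_small m0 zn); rewrite (addrC _ (z - _)) subrK.
Qed.

Lemma model_half_odd n : model ((-1) ^+ n) (half_odd R n) = half_odd R n.+1.
Proof.
have w0 : 1000 * n.+1%:R * cabs (0 : CC R) <= 1 by rewrite cabs0 mulr0 ler01.
have := model_wander w0; rewrite addr0 cabs0 expr0n /= !mulr0 => h.
by apply/subr0_eq/cabs_eq0/le_anti; rewrite h cabs_ge0.
Qed.

Lemma Re_half_odd k : complex.Re (half_odd R k) = k%:R + 2^-1.
Proof. by rewrite /half_odd half_real -(rmorph_nat (real_complex R)). Qed.

Lemma half_odd_neq0 n : half_odd R n != 0.
Proof.
apply/eqP => /(congr1 (fun z : CC R => complex.Re z)).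
by rewrite Re_half_odd /=; have := ler0n R n; lra.
Qed.

(** A polynomial vanishing at all natural numbers is zero, whereas the model takes
the value [k + 3/2] at [k + 1/2]. *)
Lemma transcendental_model k :
  transcendental_entire (model ((-1) ^+ k : CC R)).
Proof.
split; first exact: entire_model.
move=> [p Hp].
have p0 : p = 0.
  apply: (@roots_geq_poly_eq0 _ p [seq i%:R | i <- iota 0 (size p)]).
  - apply/allP => _ /mapP[i _ ->]; rewrite /root -Hp.
    by rewrite /model csinpi_nat !mul0r.
  - rewrite map_inj_uniq ?iota_uniq // => i j /eqP.
    by rewrite eqr_nat => /eqP.
  - by rewrite size_map size_iota.
have := model_half_odd k; rewrite Hp p0 horner0 => /esym/eqP.
by rewrite (negbTE (half_odd_neq0 _)).
Qed.
End Orbits.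

Section Composition.
Variables (R : realType) (rho : R) (h1 h2 : CC R -> CC R).
Hypotheses (c1 : contracts h1 rho) (c2 : contracts h2 rho).

Lemma contracts_disc h z : contracts h rho -> disc 0 rho z -> disc 0 rho (h z).
Proof.
move=> ch zB; exact: (@iter_disc _ h rho ch 1).
Qed.

Lemma contracts_comp : contracts (h1 \o h2) rho.
Proof.
have [k1 rho0 half1] := c1; have [k2 _ half2] := c2.
split; [move=> z|exact: rho0|move=> z zB].
  by apply: continuous_comp; [exact: k2|exact: k1].
 have := half1 _ (contracts_disc c2 zB); have := half2 _ zB.
rewrite /=; have := cabs_ge0 (h2 z); lra.
Qed.
End Composition.

Theorem theorem2p15 (R : realType) :
  exists (f g : CC R -> CC R) (D : set (CC R)),
    transcendental_entire f /\ transcendental_entire g /\ domain D /\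
    lies_in_preperiodic f D /\ lies_in_preperiodic g D /\
    lies_in_preperiodic (g \o f) D /\ lies_in_wandering (f \o g) D.
Proof.
pose f : CC R -> CC R := model ((-1) ^+ 1); pose g : CC R -> CC R := model ((-1) ^+ 0).
have cf : contracts f (1 / 128) by apply: contracts_model; rewrite expr1 cabsN cabs1.
have cg : contracts g (1 / 128) by apply: contracts_model; rewrite expr0 cabs1.
have fdrop z : disc (half_odd R 0) (radius R 0) z -> disc 0 (1 / 128) (f z).
  by move/model_drop; rewrite /f expr0 expr1.
have gdrop z : disc (half_odd R 1) (radius R 1) z -> disc 0 (1 / 128) (g z).
  by move/model_drop; rewrite /g expr1 opprK expr0.
(* The same f and g, indexed by the parity of the half-odd integer to be moved. *)
have gE k : g = model ((-1) ^+ k.*2) by rewrite -muln2 mulnC exprM sqrrN !expr1n.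
have fE k : f = model ((-1) ^+ k.*2.+1).
  by rewrite exprS -muln2 mulnC exprM sqrrN !expr1n mulr1.
pose D := disc (half_odd R 0) (radius R 0).
have DD : domain D by apply: domain_disc; exact: radius_gt0.
have Dc : D (half_odd R 0) by apply: disc_center; exact: radius_gt0.
exists f, g, D; do 3![split; [by [exact: transcendental_model | exact: DD]|]].
split.
  by apply: (lies_in_preperiodic_basin cf DD) => z zD; exists 1%N; exact: fdrop.
split.
  apply: (lies_in_preperiodic_basin cg DD) => z zD; exists 2%N; apply: gdrop.
  exact: (@model_chain R 0).
split.
  apply: (lies_in_preperiodic_basin (contracts_comp cg cf) DD) => z zD.
  by exists 1%N; exact: (contracts_disc cg (fdrop z zD)).
have cfg := contracts_comp cf cg.
have chain k z : D z -> disc (half_odd R k.*2) (radius R k.*2) (iter k (f \o g) z).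
  move=> zD; elim: k => [//|k IH].
  by have := model_chain (model_chain IH); rewrite -(fE k) -(gE k) doubleS.
have center k : iter k (f \o g) (half_odd R 0) = half_odd R k.*2.
  elim: k => [//|k IH].
  by rewrite iterS IH /= (gE k) model_half_odd (fE k) model_half_odd doubleS.
apply: (lies_in_wandering_separated (x := half_odd R 0)
          (a := fun k => k.*2.+1%:R) cfg) => //.
- suff nD : normal_family D (iterates (f \o g)) by move=> z zD; exists D.
  apply: normal_iterates_infinity => M.
  pose n0 := Num.bound `|M|; exists n0 => n nn0 z zD.
  have Mn : M < n%:R.
    apply: (le_lt_trans (ler_norm M)).
    apply: (lt_le_trans (archi_boundP (normr_ge0 M))); by rewrite ler_nat.
  apply: (lt_le_trans Mn).
  have := chain n z zD; set w := iter n _ z; rewrite /disc /= => wd.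
  have h := Re_le_cabs (w - half_odd R n.*2).
  have := radius_le_half R n.*2.
  have := Re_le_cabs w; have := ler_norm (complex.Re w).
  move: h; rewrite raddfB /= Re_half_odd ler_norml => /andP[h _].
  have : n%:R <= n.*2%:R :> R by rewrite ler_nat -addnn leq_addr.
  lra.
- move=> [n]; rewrite center /disc /= subr0.
  have := Re_le_cabs (half_odd R n.*2); have := ler_norm (complex.Re (half_odd R n.*2)).
  rewrite Re_half_odd; have := ler0n R n.*2; lra.
- move=> n; rewrite !center !Re_half_odd doubleS.
  rewrite -[n.*2.+2%:R]natr1 -[n.*2.+1%:R]natr1; apply/andP; split; lra.
- move=> n z zn; exists 1%N; apply: contracts_disc cf _.
  by apply: (@model_line R _ z n.*2.+1) => //; rewrite expr0 cabs1.
Qed.
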